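(* Assume a Turing instability occurs at $\mu=0$, and consider the stripes on the domain $[0,4\pi/\kappa]\times[0,4\pi/(\sqrt3\kappa)]$ ($\kappa=k_c+\tilde\kappa$, rescaled to $\Omega_3=[0,4\pi]\times[0,4\pi/\sqrt3]$) with periodic boundary conditions, scaling $(A,\alpha,\beta,\tilde\kappa)=(\varepsilon A',\varepsilon^2\alpha',\varepsilon\beta',\varepsilon\kappa')$, and velocity parameter $c=c(\mu)=-\lambda_\beta+\mathcal{O}(\varepsilon)$ of the stripes. The eigenvalues of the matrix $L_2^{\rm hex}$ (the subblock of the linearisation in stripes defined in the context) are $$\lambda_\pm=\varepsilon^2\left(A'^2(3k_0-q_2+8q_1)-\frac34\rho_\beta\beta'^2\pm A'\left|\frac{2q}{\varepsilon}+p(\mu_1)\right|\right)+\mathcal{O}(\varepsilon^3),$$ where $A'=\sqrt{-(\alpha'+\rho_\beta\beta'^2+\rho_\kappa\kappa'^2)/\rho_{\rm nl}}+\mathcal{O}(\varepsilon)$.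
   Context: System: $u_t=D\Delta u+Lu+\check\alpha Mu+\beta Bu_x+Q[u,u]+K[u,u,u]$, $u\in\mathbb{R}^2$, $\mathbf{x}=(x,y)\in\mathbb{R}^2$; $D=\mathrm{diag}(d_1,d_2)$, $d_i>0$; $L=\begin{pmatrix}a_1&a_2\\ a_3&a_4\end{pmatrix}$ and $M$ real $2\times2$ matrices; $Q$, $K$ symmetric bilinear/trilinear on $\mathbb{R}^2$, extended multilinearly to $\mathbb{C}^2$; $B=B(c)=\mathrm{diag}(1+c,c)$ with $c\in\mathbb{R}$. Turing instability with wavenumber $k_c>0$ at $\check\alpha=\beta=0$: with $\hat{\mathcal L}(k,\ell)=-(k^2+\ell^2)D+L+\check\alpha M+\mathrm{i}k\beta B$ and $d(\lambda,k,\ell)=\det(\hat{\mathcal L}(k,\ell)-\lambda\,\mathrm{Id})$, at $\check\alpha=\beta=0$: (1) all eigenvalues of $L$ have negative real part; (2) $d=0$ and $\mathrm{Re}\,\lambda\ge0$ iff $\lambda=0$ and $k^2+\ell^2=k_c^2$; (3) $\partial_\lambda d\ne0$ there. Set $\lambda_M:=-\partial_{\check\alpha}d/\partial_\lambda d$ (at $\check\alpha=0,\lambda=0$), assumed nonzero, and $\alpha:=\lambda_M\check\alpha$. Coefficients: $E_0,E_0^*\in\mathbb{R}^2$ span the kernels of $-k_c^2D+L$ and its transpose, $\langle E_0,E_0\rangle=\langle E_0,E_0^*\rangle=1$. $(-k_c^2D+L)^{-1}$ denotes the inverse from the range to the kernel of the projection $\langle\cdot,E_0^*\rangle E_0$.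 All coefficients are evaluated at $\mu=0$, where $c=-\lambda_\beta$, $\lambda_\beta=\frac{a_4-k_c^2d_2}{a_1+a_4-k_c^2(d_1+d_2)}$, so $\langle BE_0,E_0^*\rangle=0$. Define $Q_0=-2L^{-1}Q[\overline{E_0},E_0]$, $Q_2=-2(-4k_c^2D+L)^{-1}Q[E_0,E_0]$, $q_0=\langle Q[E_0,Q_0],E_0^*\rangle$, $q_2=\langle Q[\overline{E_0},Q_2],E_0^*\rangle$, $k_0=\langle K[E_0,E_0,\overline{E_0}],E_0^*\rangle$, $\rho_{\rm nl}=3k_0+2q_0+q_2$, $w_{A\beta}=k_c(-k_c^2D+L)^{-1}(\langle BE_0,E_0^*\rangle-B)E_0$, $w_{A\kappa}=2k_c(-k_c^2D+L)^{-1}DE_0$, $\rho_\beta=-k_c\langle Bw_{A\beta},E_0^*\rangle>0$, $\rho_\kappa=-2k_c\langle Dw_{A\kappa},E_0^*\rangle<0$. Standing assumption: $\rho_{\rm nl}<0$. Scaling: as in the claim, with $0<\varepsilon\ll1$ and primed quantities bounded; $\mu=(\alpha,\beta,\tilde\kappa)=\varepsilon\mu_1+\varepsilon^2\mu_2$, so $\mu_1$ carries $(\beta',\kappa')$. Stripes (known existence result): nontrivial small travelling waves constant in $y$, $2\pi/\kappa$-periodic in $x$, velocity $\beta c$ with $c=c(\mu)=-\lambda_\beta+\mathcal{O}(\varepsilon)$, leading-order profile $2\varepsilon A'E_0\cos(\kappa x)$ up to translation, in 1-to-1 correspondence with solutions $A=\varepsilon A'>0$ of $\varepsilon^2(\alpha'+\rho_\beta\beta'^2+\rho_\kappa\kappa'^2+\rho_{\rm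 nl}A'^2+\mathcal{O}(\varepsilon))=0$. The matrix $L_2^{\rm hex}$: on $\Omega_3$ there is a six-dimensional centre manifold with coordinates $u_c=\sum_{j=\pm1,\pm2,\pm3}u_j\mathrm{e}^{\mathrm{i}\mathbf{k}_j\cdot\mathbf{x}}E_0$, $\mathbf{k}_1=(1,0)$, $\mathbf{k}_2=(-1/2,\sqrt3/2)$, $\mathbf{k}_3=-(1/2,\sqrt3/2)$, $\mathbf{k}_{-j}=-\mathbf{k}_j$. The linearisation of the reduced ODE in stripes in index ordering $(1,-1,2,-3,3,-2)$ is $\mathrm{diag}(L_1,L_2^{\rm hex},L_2^{\rm hex})+\mathcal{O}(\varepsilon^3)$ with $$L_2^{\rm hex}=\varepsilon^2\begin{pmatrix}\lambda'_{\mu,2}+A'^2\eta&2A'\frac{q}{\varepsilon}+A'p(\mu_1)\\2A'\frac{q}{\varepsilon}+A'\overline{p(\mu_1)}&\lambda'_{\mu,2}+A'^2\eta\end{pmatrix},$$ $\lambda'_{\mu,2}=\alpha'+\frac14\rho_\beta\beta'^2+\rho_\kappa\kappa'^2+\mathcal{O}(\varepsilon)$ (real), $q=\langle Q[E_0,E_0],E_0^*\rangle$, $\eta=6k_0+2q_0+8q_1$, $q_1=\langle Q[E_0,Q_1],E_0^*\rangle$, $Q_1=(-k_c^2D+L)^{-1}(\langle Q[E_0,E_0],E_0^*\rangle E_0-Q[E_0,E_0])$, $p(\mu_1)=\langle Q[\mathrm{i}\beta'w_{A\beta}+4\kappa'w_{A\kappa},E_0],E_0^*\rangle+\langle(-4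\kappa'k_cD-\mathrm{i}\beta'k_cB)Q_1,E_0^*\rangle$.
   Formalization: The expansion A' = sqrt(-(α'+ρ_β β'^2+ρ_κ κ'^2)/ρ_nl) + O(ε) is stated only when the quantity under the root stays bounded away from 0 as ε→0, since at 0 only O(√ε) holds; the eigenvalue formula needs no such condition. *)

(* Defs.v *)
From HB Require Import structures.
From mathcomp Require Import all_boot all_order all_algebra.
From mathcomp Require Import complex.
From mathcomp Require Import all_classical all_reals all_analysis.

Set Implicit Arguments.
Unset Strict Implicit.
Unset Printing Implicit Defensive.

Import Order.TTheory GRing.Theory Num.Theory numFieldNormedType.Exports.
Import ComplexField.

Local Open Scope classical_set_scope.
Local Open Scope ring_scope.
Local Open Scope complex_scope.

Definition mx22 (T : Type) (a b c d : T) : 'M[T]_2 :=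
  \matrix_(i, j) if i == 0 then (if j == 0 then a else b)
                 else (if j == 0 then c else d).

Definition dotv (T : pzRingType) (u v : 'cV[T]_2) : T :=
  \sum_i u i 0 * v i 0.

(* Entrywise embedding of real matrices into complex ones. *)
Definition toC (R : rcfType) (m n : nat) (A : 'M[R]_(m, n)) : 'M[R[i]]_(m, n) :=
  map_mx (real_complex R) A.

(* Complex-bilinear extension of a real-bilinear map. *)
Definition bilinC (R : rcfType) (F : 'cV[R]_2 -> 'cV[R]_2 -> 'cV[R]_2)
    (u v : 'cV[R[i]]_2) : 'cV[R[i]]_2 :=
  let re := map_mx (@complex.Re R) in
  let im := map_mx (@complex.Im R) in
  toC (F (re u) (re v) - F (im u) (im v))
  + 'i%C *: toC (F (re u) (im v) + F (im u) (re v)).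

(* u_t = D (u_xx + u_yy) + L u + ac M u + be B u_x + Q[u,u] + K[u,u,u].
   Symmetry makes linearity in the first argument suffice. *)
Record rd_system (R : realType) := RDSystem {
  d1 : R; d2 : R;
  L : 'M[R]_2; M : 'M[R]_2;
  Q : 'cV[R]_2 -> 'cV[R]_2 -> 'cV[R]_2;
  K : 'cV[R]_2 -> 'cV[R]_2 -> 'cV[R]_2 -> 'cV[R]_2;
  d1_gt0 : 0 < d1; d2_gt0 : 0 < d2;
  Q_sym : forall u v, Q u v = Q v u;
  Q_lin : forall v, linear (fun u => Q u v);
  K_sym12 : forall u v w, K u v w = K v u w;
  K_sym23 : forall u v w, K u v w = K u w v;
  K_lin : forall v w, linear (fun u => K u v w) }.

Definition D (R : realType) (S : rd_system R) : 'M[R]_2 :=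
  mx22 (d1 S) 0 0 (d2 S).

Definition Bc (R : realType) (c : R) : 'M[R]_2 := mx22 (1 + c) 0 0 c.

(* Fourier symbol of the linearisation at 0, and its dispersion function. *)
Definition symbol (R : realType) (S : rd_system R) (ac be c k l : R) :
    'M[R[i]]_2 :=
  toC (- (k ^+ 2 + l ^+ 2) *: D S + L S + ac *: M S)
  + ('i%C * (k * be)%:C) *: toC (Bc c).

Definition disp (R : realType) (S : rd_system R) (ac be c : R) (lam : R[i])
    (k l : R) : R[i] :=
  \det (symbol S ac be c k l - lam%:M).

(* Complex derivative of d in lambda at lambda = 0; at be = 0 the parameter c
   does not enter. *)
Definition disp_lam (R : realType) (S : rd_system R) (k l : R) : R[i] :=
  derive1 (fun lam : R[i] => disp S 0 0 0 lam k l : R[i]^o) 0.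

Definition turing_instability (R : realType) (S : rd_system R) (kc : R) : Prop :=
  [/\ 0 < kc,
      forall lam : R[i], eigenvalue (toC (L S)) lam -> complex.Re lam < 0,
      forall (k l : R) (lam : R[i]),
        (disp S 0 0 0 lam k l = 0 /\ 0 <= complex.Re lam) <->
        (lam = 0 /\ k ^+ 2 + l ^+ 2 = kc ^+ 2)
    & forall k l : R, k ^+ 2 + l ^+ 2 = kc ^+ 2 -> disp_lam S k l != 0].

(* At be = 0 and lambda = 0 both partial derivatives of d are real and depend
   on (k, l) only through k^2 + l^2, so (kc, 0) represents the circle. *)
Definition lambda_M (R : realType) (S : rd_system R) (kc : R) : R :=
  - derive1 (fun ac : R => complex.Re (disp S ac 0 0 0 kc 0)) 0
    / complex.Re (disp_lam S kc 0).

Definition Lkc (R : realType) (S : rd_system R) (kc : R) : 'M[R]_2 :=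
  - kc ^+ 2 *: D S + L S.

Definition critical_vectors (R : realType) (S : rd_system R) (kc : R)
    (E0 E0s : 'cV[R]_2) : Prop :=
  [/\ forall v : 'cV[R]_2, Lkc S kc *m v = 0 <-> exists a : R, v = a *: E0,
      forall v : 'cV[R]_2,
        (Lkc S kc)^T *m v = 0 <-> exists a : R, v = a *: E0s,
      dotv E0 E0 = 1
    & dotv E0 E0s = 1].

Definition lambda_beta (R : realType) (S : rd_system R) (kc : R) : R :=
  (L S 1 1 - kc ^+ 2 * d2 S)
  / (L S 0 0 + L S 1 1 - kc ^+ 2 * (d1 S + d2 S)).

Section Coefficients.
Variables (R : realType) (S : rd_system R) (kc : R) (E0 E0s : 'cV[R]_2).

(* (-kc^2 D + L)^-1, from the range of -kc^2 D + L to the kernel of the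
   projection <., E0s> E0. *)
Definition Lkc_inv (v : 'cV[R]_2) : 'cV[R]_2 :=
  xget 0 [set w | Lkc S kc *m w = v /\ dotv w E0s *: E0 = 0].

Definition B0 : 'M[R]_2 := Bc (- lambda_beta S kc).

(* E0 is real, so its complex conjugate is E0 itself. *)
Definition Q0 : 'cV[R]_2 := - 2 *: (invmx (L S) *m Q S E0 E0).
Definition Q2 : 'cV[R]_2 :=
  - 2 *: (invmx (- (4 * kc ^+ 2) *: D S + L S) *m Q S E0 E0).
Definition Q1 : 'cV[R]_2 :=
  Lkc_inv (dotv (Q S E0 E0) E0s *: E0 - Q S E0 E0).

Definition q : R := dotv (Q S E0 E0) E0s.
Definition q0 : R := dotv (Q S E0 Q0) E0s.
Definition q1 : R := dotv (Q S E0 Q1) E0s.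
Definition q2 : R := dotv (Q S E0 Q2) E0s.
Definition k0 : R := dotv (K S E0 E0 E0) E0s.
Definition rho_nl : R := 3 * k0 + 2 * q0 + q2.
Definition eta : R := 6 * k0 + 2 * q0 + 8 * q1.

Definition wAbeta : 'cV[R]_2 :=
  kc *: Lkc_inv (dotv (B0 *m E0) E0s *: E0 - B0 *m E0).
Definition wAkappa : 'cV[R]_2 := (2 * kc) *: Lkc_inv (D S *m E0).

Definition rho_beta : R := - kc * dotv (B0 *m wAbeta) E0s.
Definition rho_kappa : R := - (2 * kc) * dotv (D S *m wAkappa) E0s.

Definition p (beta' kappa' : R) : R[i] :=
  dotv (bilinC (Q S)
          (('i%C * beta'%:C) *: toC wAbeta + (4 * kappa')%:C *: toC wAkappa)
          (toC E0))
       (toC E0s)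
  + dotv ((- (4 * kappa' * kc)%:C *: toC (D S)
           - ('i%C * (beta' * kc)%:C) *: toC B0) *m toC Q1)
         (toC E0s).

(* lam2 stands for lambda'_{mu,2}. *)
Definition L2hex (eps A' beta' kappa' lam2 : R) : 'M[R[i]]_2 :=
  (eps ^+ 2)%:C *:
  mx22 (lam2 + A' ^+ 2 * eta)%:C
       ((2 * A' * (q / eps))%:C + A'%:C * p beta' kappa')
       ((2 * A' * (q / eps))%:C + A'%:C * (p beta' kappa')^*%C)
       (lam2 + A' ^+ 2 * eta)%:C.

End Coefficients.

(* A nontrivial stripe: since the system is written in the frame moving with
   velocity be * c (the c-part of B), a travelling wave that is constant in y
   is a steady profile u(x). *)
Definition stripe (R : realType) (S : rd_system R) (ac be kappa c : R)
    (u : R -> 'cV[R]_2) : Prop :=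
  [/\ forall x, derivable u x 1 /\ derivable (derive1 u) x 1,
      forall x, u (x + 2 * pi / kappa) = u x,
      exists x, u x != 0
    & forall x, D S *m derive1n 2 u x + L S *m u x + ac *: (M S *m u x)
                + be *: (Bc c *m derive1 u x)
                + Q S (u x) (u x) + K S (u x) (u x) (u x) = 0].

(* Main.v *)
(** Both diagonal entries of L2hex are equal and real and its off-diagonal
entries are complex conjugates [b] and [b^*], so its eigenvalues are
[a + |b|] and [a - |b|]. The diagonal is brought to the stated form by the
amplitude equation: since [eta = rho_nl + 3 k0 - q2 + 8 q1], solving it for
[alpha' + rho_kappa kappa'^2] cancels the [rho_nl A'^2] part of [eta A'^2] and
leaves [- 3/4 rho_beta beta'^2], and so no expansion of [A'] itself is
needed. Away from its zero, that expansion follows from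
[x - sqrt y = (x^2 - y) / (x + sqrt y)]. *)
Require Import Defs.
From mathcomp Require Import all_boot all_order all_algebra.
From mathcomp Require Import complex.
From mathcomp Require Import all_classical all_reals all_analysis.
From mathcomp Require Import ring lra.
Import Order.TTheory GRing.Theory Num.Theory numFieldNormedType.Exports.
Import ComplexField.
Local Open Scope classical_set_scope.
Local Open Scope ring_scope.
Local Open Scope complex_scope.

Lemma eigenvalue_det (F : fieldType) (n : nat) (g : 'M[F]_n) (a : F) :
  eigenvalue g a = (\det (g - a%:M) == 0).
Proof.
by rewrite /eigenvalue /eigenspace kermx_eq0 row_free_unit unitmxE unitfE negbK.
Qed.

Lemma det_mx22 (F : comPzRingType) (a b c d : F) :
  \det (mx22 a b c d) = a * d - b * c.
Proof.
rewrite (expand_det_row _ 0) !big_ord_recl big_ord0 /cofactor !det_mx11 !mxE /=.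
by rewrite expr0 expr1; ring.
Qed.

Lemma mul_normc_conj (R : rcfType) (x : R[i]) :
  x * x^*%C = (Normc.normc x)%:C ^+ 2.
Proof. by rewrite -sqr_normc normc_def; case: x. Qed.

Lemma normc_real (R : rcfType) (x : R) : Normc.normc x%:C = `|x|.
Proof. by rewrite /Normc.normc /= expr0n addr0 sqrtr_sqr. Qed.

(** Since [b * b^*] is the square of the real number [|b|], the characteristic polynomial is the
    difference of squares [(a - z)^2 - |b|^2], which splits into two linear factors. *)
Lemma eigenvalue_mx22_conj (R : rcfType) (a : R) (b z : R[i]) :
  eigenvalue (mx22 a%:C b b^*%C a%:C) z <->
  z = (a + Normc.normc b)%:C \/ z = (a - Normc.normc b)%:C.
Proof.
rewrite eigenvalue_det.
have -> : mx22 a%:C b b^*%C a%:C - z%:M = mx22 (a%:C - z) b b^*%C (a%:C - z).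
  apply/matrixP => i j; rewrite !mxE.
  by case: i => [[|[|]]] // ?; case: j => [[|[|]]] // ?; rewrite /= ?subr0.
rewrite det_mx22 mul_normc_conj -expr2 subr_sqr mulf_eq0.
rewrite rmorphB rmorphD /=; set c := (Normc.normc b)%:C.
rewrite ![a%:C - z + _]addrAC !subr_eq0.
by rewrite ![_ == z]eq_sym orbC; split=> [/orP[]/eqP|[]->]; [left|right|..];
  rewrite ?eqxx ?orbT.
Qed.

(** Conjugation fixes the real scalars [eps], [A'] and [q], so only [p] is conjugated. Collecting
    [eps ^+ 2 * A'] as a real factor of [b] lets it leave the modulus later. *)
Lemma L2hexE (R : realType) (S : rd_system R) (kc : R) (E0 E0s : 'cV[R]_2)
    (eps A' beta' kappa' lam2 : R) :
  let a := (eps ^+ 2 * (lam2 + A' ^+ 2 * eta S kc E0 E0s))%:C in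
  let b := (eps ^+ 2 * A')%:C
           * ((2 * q S E0 E0s / eps)%:C + p S kc E0 E0s beta' kappa') in
  L2hex S kc E0 E0s eps A' beta' kappa' lam2 = mx22 a b b^*%C a.
Proof.
rewrite /L2hex /=; move: (p _ _ _ _ _ _) => z.
have conjE (x y : R) : (x%:C * (y%:C + z))^*%C = x%:C * (y%:C + z^*%C).
  by rewrite (rmorphM conjc) (rmorphD conjc) /= !oppr0.
rewrite {}conjE.
have -> : 2 * A' * (q S E0 E0s / eps) = A' * (2 * q S E0 E0s / eps) by ring.
rewrite !(rmorphM (real_complex R) (eps ^+ 2)) !(rmorphM (real_complex R) A').
rewrite -!mulrDr.
apply/matrixP => i j; rewrite !mxE.
by case: i => [[|[|]]] // ?; case: j => [[|[|]]] // ?; rewrite /= ?mulrA.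
Qed.

Theorem lemma3p11 (R : realType) (S : rd_system R) (kc : R)
    (E0 E0s : 'cV[R]_2)
    (turing : turing_instability S kc)
    (crit : critical_vectors S kc E0 E0s)
    (lambda_M_neq0 : lambda_M S kc != 0)
    (rho_nl_lt0 : rho_nl S kc E0 E0s < 0)
    (* scaled parameters, bounded as eps -> 0+ *)
    (alpha' beta' kappa' : R -> R)
    (alpha'_bnd : alpha' =O_ (0^'+) (cst 1 : R -> R))
    (beta'_bnd : beta' =O_ (0^'+) (cst 1 : R -> R))
    (kappa'_bnd : kappa' =O_ (0^'+) (cst 1 : R -> R))
    (* stripes, their velocity parameter and their amplitude eps * A' *)
    (c : R -> R) (us : R -> R -> 'cV[R]_2) (A' : R -> R)
    (c_exp : (fun eps => c eps + lambda_beta S kc) =O_ (0^'+) (fun eps : R => eps))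
    (us_stripe : \forall eps \near 0^'+,
       stripe S (eps ^+ 2 * alpha' eps / lambda_M S kc) (eps * beta' eps)
         (kc + eps * kappa' eps) (c eps) (us eps))
    (us_profile : exists C : R, \forall eps \near 0^'+, forall x : R,
       `|us eps x - (2 * eps * A' eps * cos ((kc + eps * kappa' eps) * x)) *: E0|
       <= C * eps ^+ 2)
    (A'_gt0 : \forall eps \near 0^'+, 0 < A' eps)
    (rem_A : R -> R) (rem_A_O : rem_A =O_ (0^'+) (fun eps : R => eps))
    (A'_eq : \forall eps \near 0^'+,
       eps ^+ 2 * (alpha' eps + rho_beta S kc E0 E0s * beta' eps ^+ 2
                   + rho_kappa S kc E0 E0s * kappa' eps ^+ 2
                   + rho_nl S kc E0 E0s * A' eps ^+ 2 + rem_A eps) = 0)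
    (* lambda'_{mu,2} *)
    (lam2 : R -> R)
    (lam2_exp : (fun eps => lam2 eps
                   - (alpha' eps + 4^-1 * rho_beta S kc E0 E0s * beta' eps ^+ 2
                      + rho_kappa S kc E0 E0s * kappa' eps ^+ 2))
                =O_ (0^'+) (fun eps : R => eps)) :
  let lead (sgn : R) (eps : R) : R :=
    eps ^+ 2 *
    (A' eps ^+ 2 * (3 * k0 S E0 E0s - q2 S kc E0 E0s + 8 * q1 S kc E0 E0s)
     - 3 / 4 * rho_beta S kc E0 E0s * beta' eps ^+ 2
     + sgn * (A' eps * Normc.normc ((2 * q S E0 E0s / eps)%:C
                          + p S kc E0 E0s (beta' eps) (kappa' eps)))) in
  let A'2_lead (eps : R) : R :=
    - (alpha' eps + rho_beta S kc E0 E0s * beta' eps ^+ 2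
       + rho_kappa S kc E0 E0s * kappa' eps ^+ 2) / rho_nl S kc E0 E0s in
  (exists lam_p lam_m : R -> R,
     [/\ \forall eps \near 0^'+, forall z : R[i],
           eigenvalue (L2hex S kc E0 E0s eps (A' eps) (beta' eps) (kappa' eps)
                         (lam2 eps)) z <->
           (z = (lam_p eps)%:C \/ z = (lam_m eps)%:C),
         (fun eps => lam_p eps - lead 1 eps) =O_ (0^'+) (fun eps : R => eps ^+ 3)
       & (fun eps => lam_m eps - lead (-1) eps)
           =O_ (0^'+) (fun eps : R => eps ^+ 3)])
  /\
  (* the square root is expanded away from its branch point *)
  ((exists2 delta : R, 0 < delta & \forall eps \near 0^'+, delta <= A'2_lead eps) ->
   (fun eps => A' eps - Num.sqrt (A'2_lead eps)) =O_ (0^'+) (fun eps : R => eps)).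
Proof.
move=> lead A'2_lead.
pose nq : R -> R := fun eps => Normc.normc ((2 * q S E0 E0s / eps)%:C
                          + p S kc E0 E0s (beta' eps) (kappa' eps)).
(* The factor [eps ^+ 2] of the amplitude equation cancels because [eps > 0] to the right of 0. *)
have A_eq : \forall eps \near 0^'+,
    alpha' eps + rho_beta S kc E0 E0s * beta' eps ^+ 2
    + rho_kappa S kc E0 E0s * kappa' eps ^+ 2
    + rho_nl S kc E0 E0s * A' eps ^+ 2 + rem_A eps = 0.
  near=> eps.
  have /eqP : eps ^+ 2 * (alpha' eps + rho_beta S kc E0 E0s * beta' eps ^+ 2
                   + rho_kappa S kc E0 E0s * kappa' eps ^+ 2
                   + rho_nl S kc E0 E0s * A' eps ^+ 2 + rem_A eps) = 0.
    by near: eps.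
  rewrite mulf_eq0 expf_eq0 /= => /orP[/eqP e0|/eqP //].
  by suff: 0 < eps by rewrite e0 ltxx.
split.
  (* These are the exact eigenvalues. Their modulus terms agree with those of [lead], so the
     possibly large [q / eps] contributes nothing to the error. *)
  pose lam sgn eps := eps ^+ 2 *
    (lam2 eps + A' eps ^+ 2 * eta S kc E0 E0s + sgn * (A' eps * nq eps)).
  have lamE sgn : (fun eps => lam sgn eps - lead sgn eps)
                  =O_ (0^'+) (fun eps : R => eps ^+ 3).
    have /eqO_exP[k1 k1_gt0 h1] := lam2_exp.
    have /eqO_exP[k2 k2_gt0 h2] := rem_A_O.
    apply/eqO_exP; exists (k1 + k2); first exact: addr_gt0.
    near=> eps.
    have H1 : `|lam2 eps
                   - (alpha' eps + 4^-1 * rho_beta S kc E0 E0s * beta' eps ^+ 2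
                      + rho_kappa S kc E0 E0s * kappa' eps ^+ 2)| <= k1 * `|eps|.
      by near: eps.
    have H2 : `|rem_A eps| <= k2 * `|eps| by near: eps.
    have Ae : alpha' eps + rho_beta S kc E0 E0s * beta' eps ^+ 2
      + rho_kappa S kc E0 E0s * kappa' eps ^+ 2
      + rho_nl S kc E0 E0s * A' eps ^+ 2 + rem_A eps = 0 by near: eps.
    have -> : lam sgn eps - lead sgn eps = eps ^+ 2 * (lam2 eps
                   - (alpha' eps + 4^-1 * rho_beta S kc E0 E0s * beta' eps ^+ 2
                      + rho_kappa S kc E0 E0s * kappa' eps ^+ 2) - rem_A eps).
      (* The left side of the amplitude equation is inserted as a zero next to [lam2]; what remains
         is a polynomial identity. *)
      rewrite /lam /lead -/(nq eps) -[in RHS](addr0 (lam2 eps)) -Ae /rho_nl /eta.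
      by field.
    rewrite (exprSr eps 2) !(normrM (eps ^+ 2)) [leRHS]mulrCA.
    rewrite ler_wpM2l // mulrDl.
    by rewrite (le_trans (ler_normB _ _)) // lerD.
  exists (lam 1), (lam (-1)); split=> //.
  near=> eps => z.
  have e0 : 0 < eps by [].
  have a0 : 0 < A' eps by near: eps.
  rewrite L2hexE eigenvalue_mx22_conj Normc.normcM normc_real.
  (* Positivity of [A'] fixes which eigenvalue carries which sign. *)
  rewrite gtr0_norm ?mulr_gt0 ?exprn_gt0 // -/(nq eps).
  by rewrite -!(mulrA (eps ^+ 2)) -mulrDr -mulrBr /lam mul1r mulN1r.
case=> delta d0 dl.
have rho_neq0 : rho_nl S kc E0 E0s != 0 by rewrite lt_eqF.
have s0 : 0 < Num.sqrt delta by rewrite sqrtr_gt0.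
have /eqO_exP[k k_gt0 hk] := rem_A_O.
(* Here [k] bounds [rem_A], and [Num.sqrt delta] bounds the denominator [A' + Num.sqrt A'2_lead]
   from below. *)
apply/eqO_exP; exists (k / (`|rho_nl S kc E0 E0s| * Num.sqrt delta)).
  by rewrite divr_gt0 ?mulr_gt0 ?normr_gt0.
near=> eps.
have a0 : 0 < A' eps by near: eps.
have hd : delta <= A'2_lead eps by near: eps.
have hr : `|rem_A eps| <= k * `|eps| by near: eps.
have Ae : alpha' eps + rho_beta S kc E0 E0s * beta' eps ^+ 2
  + rho_kappa S kc E0 E0s * kappa' eps ^+ 2
  + rho_nl S kc E0 E0s * A' eps ^+ 2 + rem_A eps = 0 by near: eps.
have sl : Num.sqrt delta <= A' eps + Num.sqrt (A'2_lead eps).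
  by rewrite (le_trans (ler_wsqrtr hd)) // lerDr ltW.
(* The amplitude equation reads [rho_nl * (A' ^+ 2 - A'2_lead) = - rem_A]; the lower bound [delta]
   makes the radicand nonnegative, so the square root squares back to it. *)
have diffE : rho_nl S kc E0 E0s * ((A' eps - Num.sqrt (A'2_lead eps))
    * (A' eps + Num.sqrt (A'2_lead eps))) = - rem_A eps.
  rewrite -subr_sqr sqr_sqrtr; last exact: le_trans (ltW d0) hd.
  rewrite mulrBr /A'2_lead [_ * (_ / _)]mulrC divfK //; lra.
rewrite mulrAC ler_pdivlMr ?mulr_gt0 ?normr_gt0 // (le_trans _ hr) //.
rewrite -(normrN (rem_A eps)) -diffE !normrM mulrCA.
by rewrite ler_wpM2l // ler_wpM2l // (le_trans sl) // ler_norm.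
Unshelve. all: by end_near.
Qed.
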